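(* Let $p>3$ be a prime. The polynomial $f_{3p}$ is separable over $\mathbb{F}_p$ (i.e. its reduction modulo $p$ has no repeated root in $\overline{\mathbb{F}}_p$), and hence it is also separable over $\mathbb{Z}$. Consequently, $g_{3p}$ is separable as well.
   Context: For an integer $n>1$, $F_n(x)=\sum_{0\le a\le n-1,\ \gcd(a,n)=1}x^a\in\mathbb{Z}[x]$. For $n=pq$ with odd primes $p>q$, let $$S_n=\{d>1 : d\neq q,\ d\mid p-1\}\cup\{d>1 : d\mid q-1\}\cup\{d>1 : d\mid\gcd(pq+1,p+q)\}.$$ The polynomial $f_n\in\mathbb{Z}[x]$ is defined by $F_n(x)=f_n(x)\cdot x\cdot\prod_{d\in S_n}\Phi_d(x)$, where $\Phi_d$ is the $d$-th cyclotomic polynomial. $f_n$ is a reciprocal polynomial of even degree, and $g_n$ denotes its trace polynomial: the unique polynomial with $g_n\left(x+\frac1x\right)=x^{-\deg(f_n)/2}f_n(x)$. Here $q=3$ and $n=3p$. A polynomial in $\mathbb{Z}[x]$ is separable (over $\mathbb{Z}$) if it has no repeated root in $\overline{\mathbb{Q}}$. *)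

(* Defs.v *)
From mathcomp Require Import all_boot all_order all_algebra all_field.
From mathcomp Require Import fraction.

Set Implicit Arguments.
Unset Strict Implicit.
Unset Printing Implicit Defensive.

Import Order.TTheory GRing.Theory Num.Theory.
Local Open Scope ring_scope.

Definition F_poly (n : nat) : {poly int} := \sum_(a < n | coprime a n) 'X^a.

(* The elements of the set $S_{pq}$, listed without repetition, so that each $\Phi_d$ occurs
   exactly once in the product below. *)
Definition S_seq (p q : nat) : seq nat :=
  undup ([seq d <- divisors p.-1 | (1 < d)%N && (d != q)]
      ++ [seq d <- divisors q.-1 | (1 < d)%N]
      ++ [seq d <- divisors (gcdn (p * q + 1) (p + q)) | (1 < d)%N]).

(* [f] is the polynomial $f_{pq}$; it is unique since the other factors are
   monic. *)
Definition is_f_poly (p q : nat) (f : {poly int}) : Prop :=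
  F_poly (p * q) = f * 'X * \prod_(d <- S_seq p q) 'Phi_d.

(* [g] is the trace polynomial of [f]: the identity
   $g(x + 1/x) = x^{-\deg(f)/2} f(x)$, read in the field of fractions of
   $\mathbb{Z}[x]$. *)
Definition is_trace_poly (f g : {poly int}) : Prop :=
  let x : {fraction {poly int}} := tofrac 'X in
  (map_poly (fun c : int => c%:~R) g).[x + x^-1]
    = x ^- ((size f).-1)./2 * tofrac f.

Definition no_repeated_root (K : fieldType) (h : {poly K}) : Prop :=
  forall x : K, ~~ (('X - x%:P) ^+ 2 %| h).

(* [algC] is $\overline{\mathbb{Q}}$. *)
Definition separable_over_Z (h : {poly int}) : Prop :=
  no_repeated_root (map_poly intr h : {poly algC}).

(* [K] ranges over the algebraic closures of ['F_p]; such a field exists by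
   [countable_algebraic_closure]. *)
Definition separable_over_Fp (p : nat) (h : {poly int}) : Prop :=
  forall (K : closedFieldType) (iota : {rmorphism 'F_p -> K}),
    integralRange iota ->
    no_repeated_root (map_poly iota (map_poly intr h)).

(* Main.v *)
Require Import Defs.
From mathcomp Require Import all_boot all_order all_algebra all_field.
From mathcomp Require Import fraction ring.

(** Put [u = X^2 + X + 1] and [v = X - 1], so that [X^3 - 1 = u v].  Counting
    the integers below [3p] prime to [3p] by inclusion-exclusion, and using the
    Frobenius identity [X^(3p) - 1 = (u v)^p], one finds that modulo [p]
      [F = u^p v^(p-1) - (u v)^(p-1) - u^p + 1]   and   [F' = - (u v)^(p-2) Q]
    with [Q = X^4 + 2 X^3 + 2 X + 1] ([F_poly_mod_p], [deriv_F_poly_mod_p]).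

    Let [a] be a repeated root of [f] in a field of characteristic [p], hence of
    [F].  Neither [u] nor [v] vanishes at [a], because [F] is [1] where [u]
    vanishes and [-2] where [v] vanishes; so [Q(a) = 0], and [b = a^p] is also a
    root of [Q].  Multiplied by [u(a) v(a)], the equation [F(a) = 0] says that
    [h(a) = h(b)] for the rational function [h = (X^2 + X) / (X^3 - 1)] of
    degree 3, whose derivative is [- Q / (X^3 - 1)^2].  If [a] and [b] were
    distinct, the fibre of [h] through them would contain two double points,
    which is too many for degree 3 ([crit_fiber]).  Therefore [a^p = a], so
    [a^(p-1) = 1], and [a] is also a root of some [Phi_d] with [d] in [S_(3p)]
    ([root_prod_Cyclotomic]).  Then [a] is a root of [F] of multiplicity at
    least 3, hence a double root of [Q]; but the discriminant of [Q] has no prime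
    factor other than 2 and 3 ([crit_separable]).

    Separability passes from characteristic [p] to characteristic 0 because [f]
    is monic: a repeated root of [f] is an algebraic integer, whose minimal
    polynomial [m] is monic with integer coefficients and satisfies [m^2 | f],
    and [m] keeps a positive degree after reduction ([separable_over_Z_lift]).

    Finally a repeated root [y] of the trace polynomial [g] produces a repeated
    root of [f], namely any [x] with [x + 1/x = y] ([trace_poly_separable]). *)

Section Separability.

Set Implicit Arguments.
Unset Strict Implicit.
Import GRing.Theory Num.Theory.
Local Open Scope ring_scope.

(** * The polynomial F of a product of two primes *)

Lemma sum_dvdn (V : nmodType) (G : nat -> V) (m n : nat) : (0 < m)%N ->
  \sum_(a < m * n | (m %| a)%N) G a = \sum_(b < n) G (m * b)%N.
Proof.
move=> m_gt0; rewrite -(big_mkord (fun a => (m %| a)%N)).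
rewrite -(big_mkord predT (fun b => G (m * b)%N)).
elim: n => [|n IHn]; first by rewrite muln0 !big_geq.
rewrite big_nat_recr //= -IHn (@big_cat_nat _ _ _ (m * n)) ?leq_pmul2l //=.
congr (_ + _); rewrite big_ltn_cond ?ltn_pmul2l // dvdn_mulr //.
rewrite big_nat_cond big_pred0 ?addr0 // => a.
apply/negP => /andP [/andP [lo hi] /dvdnP [c ac]].
by move: lo hi; rewrite ac (mulnC c) !ltn_pmul2l // ltnS ltnNge => /negbTE ->.
Qed.

(** Inclusion-exclusion over the multiples of [p], of [q], and of [p * q]; the
    last ones contribute only the exponent 0. *)
Lemma F_polyM (p q : nat) : prime p -> prime q -> p != q ->
  F_poly (p * q) = \sum_(a < p * q) 'X^a - \sum_(b < p) 'X^(q * b)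
                   - \sum_(b < q) 'X^(p * b) + 1.
Proof.
move=> p_pr q_pr pq.
have cop_pq : coprime p q by rewrite prime_coprime // dvdn_prime2.
have [p_gt0 q_gt0] := (prime_gt0 p_pr, prime_gt0 q_pr).
have E1 : \sum_(a < p * q | (p * q %| a)%N) 'X^a = 1 :> {poly int}.
  have := @sum_dvdn _ (fun a => 'X^a : {poly int}) (p * q) 1.
  by rewrite muln1 big_ord1 muln0 muln_gt0 p_gt0 q_gt0; apply.
rewrite -E1 -!(@sum_dvdn _ (fun a => 'X^a : {poly int})) // (mulnC q p).
rewrite /F_poly !(big_mkcond (fun a : 'I__ => coprime _ _)) /=.
rewrite !(big_mkcond (fun a : 'I__ => (_ %| _)%N)) /= -!sumrN -!big_split /=.
apply: eq_bigr => a _.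
rewrite coprimeMr coprime_sym (coprime_sym a q) !prime_coprime // Gauss_dvd //.
by case: (p %| a)%N; case: (q %| a)%N;
  rewrite /= ?subr0 ?addr0 ?subrr ?subrK // addrN sub0r addNr.
Qed.

Lemma F_poly_monic (n : nat) : (1 < n)%N -> F_poly n \is monic.
Proof.
case: n => [|[|n]] // _; rewrite /F_poly big_mkcond big_ord_recr /= coprimenS.
rewrite monicE lead_coefDr ?lead_coefXn // size_polyXn ltnS.
apply: (leq_trans (size_sum _ _ _)); apply/bigmax_leqP => i _.
by case: ifP; rewrite ?size_poly0 // size_polyXn ltn_ord.
Qed.

Lemma f_poly_monic (p q : nat) (f : {poly int}) :
  (1 < p * q)%N -> is_f_poly p q f -> f \is monic.
Proof.
move=> pq_gt1 fE; have := F_poly_monic pq_gt1; rewrite fE -mulrA !monicE.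
rewrite lead_coef_Mmonic // monicMl ?monicX // monic_prod // => d _.
exact: Cyclotomic_monic.
Qed.

(** * The cyclotomic factors *)

Lemma Cyclotomic1 : 'Phi_1 = 'X - 1.
Proof. by have := @prod_Cyclotomic 1 isT; rewrite big_seq1. Qed.

Lemma Cyclotomic3 : 'Phi_3 = 'X^2 + 'X + 1.
Proof.
have := @prod_Cyclotomic 3 isT; rewrite big_cons big_seq1 Cyclotomic1.
have -> : 'X^3 - 1 = ('X - 1) * ('X^2 + 'X + 1) :> {poly int} by ring.
by apply: mulfI; rewrite -polyC1 polyXsubC_eq0.
Qed.

(** Apart from 1 and [q], every divisor of [p - 1] belongs to [S_(pq)]; hence a
    root of [X^(p-1) - 1] which is a root of neither [Phi_1] nor [Phi_q] is a
    root of the cyclotomic part of [F]. *)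
Lemma root_prod_Cyclotomic (K : fieldType) (p q : nat) (a : K) :
  (1 < p)%N -> a ^+ p.-1 = 1 -> a != 1 ->
  ~~ root (map_poly intr 'Phi_q) a ->
  root (map_poly intr (\prod_(d <- S_seq p q) 'Phi_d)) a.
Proof.
move=> p_gt1 ap a_neq1 aq.
have p1_gt0 : (0 < p.-1)%N by case: p p_gt1 {ap} => [|[]].
have : root (map_poly intr (\prod_(d <- divisors p.-1) 'Phi_d)) a.
  by rewrite prod_Cyclotomic // rmorphB rmorph1 /= map_polyXn rootE !hornerE ap
    subrr.
rewrite !rmorph_prod !rootE !horner_prod !prodf_seq_eq0.
case/hasP => d d_p /= da; apply/hasP; exists d => //=.
rewrite mem_undup !mem_cat mem_filter d_p andbT.
have -> : d != q by apply: contra aq => /eqP <-.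
have d_gt0 : (0 < d)%N by move: d_p; rewrite -dvdn_divisors // => /dvdn_gt0; apply.
rewrite ltn_neqAle d_gt0 !andbT; have [d1|] //= := eqVneq 1%N d.
move: da; rewrite -d1 Cyclotomic1 rmorphB rmorph1 /= map_polyX !hornerE subr_eq0.
by rewrite (negbTE a_neq1).
Qed.

(** * Repeated roots *)

Lemma map_poly_rmorph_intr (R S : nzRingType) (phi : {rmorphism R -> S})
    (h : {poly int}) :
  map_poly phi (map_poly intr h) = map_poly intr h.
Proof.
by rewrite -map_poly_comp; apply: eq_map_poly => c /=; rewrite rmorph_int.
Qed.

Lemma dvdp_deriv_XsubC_exp (K : fieldType) (h : {poly K}) (a : K) (n : nat) :
  ('X - a%:P) ^+ n.+1 %| h -> ('X - a%:P) ^+ n %| h^`().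
Proof.
case/dvdpP => k ->; rewrite derivM deriv_exp derivXsubC mul1r /= exprS.
by rewrite dvdp_add // ?mulrA ?dvdp_mulIr // mulrnAr -mulrnAl dvdp_mulIr.
Qed.

Lemma dvdp_XsubC_sqr_root (K : fieldType) (h : {poly K}) (a : K) :
  ('X - a%:P) ^+ 2 %| h -> root h a /\ root h^`() a.
Proof.
rewrite !root_factor_theorem => hh; split.
  by apply: dvdp_trans hh; rewrite expr2 dvdp_mulIl.
exact: (dvdp_deriv_XsubC_exp (n := 1) hh).
Qed.

(** * The critical quartic *)

(** The quartic [Q]: the derivative of [(X^2 + X) / (X^3 - 1)] is
    [- Q / (X^3 - 1)^2]. *)
Definition crit (R : nzRingType) : {poly R} :=
  'X^4 + 2%:R *: 'X^3 + 2%:R *: 'X + 1.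

Lemma critE (K : fieldType) (a : K) :
  (crit K).[a] = a ^+ 4 + 2%:R * a ^+ 3 + 2%:R * a + 1.
Proof. by rewrite /crit !hornerE. Qed.

Lemma crit_separable (K : fieldType) (a : K) : 2%:R != 0 :> K -> 3%:R != 0 :> K ->
  ~~ (('X - a%:P) ^+ 2 %| crit K).
Proof.
move=> n2 n3; apply/negP => /dvdp_XsubC_sqr_root [/rootP].
rewrite critE => Q0 /rootP.
rewrite /crit !derivE !hornerE /= => Q1.
(* The Bezout relation (6 - 8 X - 8 X^2) Q + (3 - 2 X + 3 X^2 + 2 X^3) Q' = 12. *)
have : 2%:R * 2%:R * 3%:R = 0 :> K.
  transitivity ((6%:R - 8%:R * a - 8%:R * a ^+ 2) * 0
      + (3%:R - 2%:R * a + 3%:R * a ^+ 2 + 2%:R * a ^+ 3) * 0 : K).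
    by rewrite -{1}Q0 -Q1; ring.
  by rewrite !mulr0 addr0.
by apply/eqP; rewrite !mulf_neq0.
Qed.

(** Outside characteristic 2, two critical points of [(X^2 + X) / (X^3 - 1)] with
    the same critical value are equal. *)
Lemma crit_fiber (K : fieldType) (a b : K) : 2%:R != 0 :> K ->
  (crit K).[a] = 0 -> (crit K).[b] = 0 ->
  (a ^+ 2 + a) * (b ^+ 3 - 1) = (b ^+ 2 + b) * (a ^+ 3 - 1) -> a = b.
Proof.
rewrite !critE => n2 Qa Qb ab; have [//|] := eqVneq a b.
rewrite -subr_eq0 => anb.
have cancel (x : K) : (a - b) * x = 0 -> x = 0.
  by move/eqP; rewrite mulf_eq0 (negbTE anb) => /eqP.
(* Dividing the equation of the fibre by [b - a] leaves a symmetric polynomial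
   [G] with [G(x, x) = Q(x)]. *)
have G0 : a ^+ 2 * b ^+ 2 + a * b * (a + b) + (a + b) + 1 = 0.
  apply: cancel; move/eqP: ab; rewrite -subr_eq0 => /eqP ab.
  by apply: oppr_inj; rewrite oppr0 -ab; ring.
(* [G(x, -)] is quadratic, with coefficients [x^2 + x], [x^2 + 1] and [x + 1],
   and has the roots [x] and [y].  Here [E1] gives their sum, and their product
   is [x y = 1 / x]. *)
have root_prod (x y : K) : (a - b) * (a - b) = (x - y) * (x - y) ->
    x ^+ 2 * y ^+ 2 + x * y * (x + y) + (x + y) + 1 = 0 ->
    x ^+ 4 + 2%:R * x ^+ 3 + 2%:R * x + 1 = 0 -> x ^+ 2 * y = 1.
  move=> xy Gxy Qx.
  have E1 : (x + y) * (x ^+ 2 + x) + (x ^+ 2 + 1) = 0.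
    apply: (cancel); apply: (cancel); rewrite mulrA xy.
    transitivity ((x - y) * (0 - 0)); last by rewrite subr0 mulr0.
    by rewrite -{1}Qx -Gxy; ring.
  have : (x + 1) * (1 - x ^+ 2 * y) = 0.
    transitivity (0 - y * 0); last by rewrite mulr0 subr0.
    by rewrite -{1}Gxy -E1; ring.
  move/eqP; rewrite mulf_eq0 => /orP [|/eqP/subr0_eq //].
  rewrite addr_eq0 => /eqP xN1; move/eqP: n2 => [].
  by apply: oppr_inj; rewrite oppr0 -Qx xN1; ring.
have Ea := root_prod a b erefl G0 Qa.
have Eb : b ^+ 2 * a = 1 by apply: root_prod => //; [ring | rewrite -G0; ring].
transitivity (a * (b ^+ 2 * a)); first by rewrite Eb mulr1.
transitivity (b * (a ^+ 2 * b)); last by rewrite Ea mulr1.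
by ring.
Qed.

(** * Separability modulo p *)

Lemma F_poly_mod_p (K : fieldType) (p : nat) : p \in [pchar K] -> p != 3 ->
  map_poly intr (F_poly (p * 3)) =
    ('X^2 + 'X + 1) ^+ p * ('X - 1) ^+ p.-1
    - (('X^2 + 'X + 1) * ('X - 1)) ^+ p.-1 - ('X^2 + 'X + 1) ^+ p + 1 :> {poly K}.
Proof.
move=> pK p3; have pKX : p \in [pchar {poly K}] by rewrite pchar_poly.
have p_pr := pcharf_prime pK; have p_gt0 := prime_gt0 p_pr.
rewrite F_polyM // rmorphD !rmorphB rmorph1 /= !rmorph_sum /=.
do 3!rewrite (eq_bigr _ (fun i _ => map_polyXn _ _)).
set u : {poly K} := 'X^2 + 'X + 1; set v : {poly K} := 'X - 1.
have v_neq0 : v != 0 by rewrite /v -polyC1 polyXsubC_eq0.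
have uv : 'X^3 - 1 = u * v by rewrite /u /v; ring.
have uv_neq0 : u * v != 0.
  by rewrite -uv -polyC1 monic_neq0 // monicXnsubC.
have frobB (x : {poly K}) : (x - 1) ^+ p = x ^+ p - 1.
  by rewrite -!(pFrobenius_autE pKX) rmorphB rmorph1.
have expp (x : {poly K}) : x ^+ p = x * x ^+ p.-1 by rewrite -exprS prednK.
congr (_ - _ - _ + 1).
- apply: (mulfI v_neq0); rewrite -subrX1 mulnC exprM -frobB uv exprMn.
  by rewrite (expp v) mulrCA.
- apply: (mulfI uv_neq0); rewrite -expp -uv frobB [RHS]subrX1.
  by congr (_ * _); apply: eq_bigr => i _; rewrite exprM.
- have -> : u ^+ p = ('X^p) ^+ 2 + 'X^p + 1.
    by rewrite -!(pFrobenius_autE pKX) /u !rmorphD rmorph1 rmorphXn.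
  by rewrite !big_ord_recl big_ord0 /= muln0 muln1 exprM; ring.
Qed.

Lemma deriv_F_poly_mod_p (K : fieldType) (p : nat) : p \in [pchar K] -> p != 3 ->
  (map_poly intr (F_poly (p * 3)))^`() =
    - (('X^2 + 'X + 1) * ('X - 1)) ^+ p.-2 * crit K.
Proof.
move=> pK p3; rewrite F_poly_mod_p //.
have p_gt1 := prime_gt1 (pcharf_prime pK).
have p0 : p%:R = 0 :> {poly K} by apply: pcharf0; rewrite pchar_poly.
have p1 : p.-1%:R = - 1 :> {poly K}.
  by rewrite -subn1 natrB ?p0 ?sub0r // ltnW.
set u : {poly K} := 'X^2 + 'X + 1; set v : {poly K} := 'X - 1.
have du : u^`() = 2%:R * 'X + 1 by rewrite /u !derivE; ring.
have dv : v^`() = 1 by rewrite /v -polyC1 derivXsubC.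
have expp (x : {poly K}) : x ^+ p = x * (x * x ^+ p.-2).
  by rewrite -!exprS; case: p p_gt1 {pK p3 p0 p1} => [|[]].
have expp1 (x : {poly K}) : x ^+ p.-1 = x * x ^+ p.-2.
  by rewrite -!exprS; case: p p_gt1 {pK p3 p0 p1 expp} => [|[]].
have Dp (x : {poly K}) : (x ^+ p)^`() = 0.
  by rewrite deriv_exp -mulr_natr p0 mulr0.
have Dp1 (x : {poly K}) : (x ^+ p.-1)^`() = - (x^`() * x ^+ p.-2).
  by rewrite deriv_exp -mulr_natr p1 mulrN1.
rewrite derivD !derivB derivM !Dp !Dp1 derivM du dv -polyC1 derivC polyC1.
rewrite expp expp1 /crit -!mul_polyC -polyC_natr /u /v !exprMn; ring.
Qed.

Lemma f_poly_mod_p_no_repeated_root (K : fieldType) (p : nat) (f : {poly int}) :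
  p \in [pchar K] -> (3 < p)%N -> is_f_poly p 3 f ->
  no_repeated_root (map_poly intr f : {poly K}).
Proof.
move=> pK p_gt3 fE a; apply/negP => dvf.
have p_pr := pcharf_prime pK.
have p3 : p != 3 by rewrite neq_ltn p_gt3 orbT.
have natK_neq0 m : (0 < m < p)%N -> m%:R != 0 :> K.
  by case/andP=> m_gt0 m_lt_p; rewrite -(dvdn_pcharf pK) gtnNdvd.
have n2 : 2%:R != 0 :> K by rewrite natK_neq0 // (ltn_trans _ p_gt3).
have n3 : 3%:R != 0 :> K by rewrite natK_neq0.
have FE : map_poly intr (F_poly (p * 3)) = map_poly intr f * 'X
    * map_poly intr (\prod_(d <- S_seq p 3) 'Phi_d) :> {poly K}.
  by rewrite fE !rmorphM /= map_polyX.
have [F0 F1] : root (map_poly intr (F_poly (p * 3))) a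
    /\ root (map_poly intr (F_poly (p * 3)))^`() a.
  by apply: dvdp_XsubC_sqr_root; rewrite FE -mulrA dvdp_mulr.
have {F0} Fa0 : (a ^+ 2 + a + 1) ^+ p * (a - 1) ^+ p.-1
    - ((a ^+ 2 + a + 1) * (a - 1)) ^+ p.-1 - (a ^+ 2 + a + 1) ^+ p + 1 = 0.
  by move/rootP: F0; rewrite F_poly_mod_p // !hornerE.
have p_gt0 := prime_gt0 p_pr.
have p1_gt0 : (0 < p.-1)%N by rewrite -subn1 subn_gt0 prime_gt1.
have expp (x : K) : x ^+ p = x * x ^+ p.-1 by rewrite -exprS prednK.
have ua : a ^+ 2 + a + 1 != 0.
  apply/eqP => u0; move/eqP: Fa0.
  by rewrite u0 mul0r !expr0n !gtn_eqF //= mul0r !subr0 add0r oner_eq0.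
have va : a != 1.
  apply/eqP => a1; move/eqP: Fa0; rewrite a1 subrr mulr0 !expr0n gtn_eqF //= mulr0.
  have -> : 1 ^+ 2 + 1 + 1 = 3%:R :> K by ring.
  rewrite -(pFrobenius_autE pK) pFrobenius_aut_nat.
  have -> : 0 - 0 - 3%:R + 1 = - 2%:R :> K by ring.
  by rewrite oppr_eq0 (negbTE n2).
have va' : a - 1 != 0 by rewrite subr_eq0.
have critP : root (crit K) a.
  move: F1; rewrite deriv_F_poly_mod_p // rootM rootN => /orP [] // /rootP.
  rewrite !hornerE => /eqP; rewrite expf_eq0 mulf_eq0 (negbTE ua) (negbTE va').
  by rewrite andbF.
have crita := rootP critP.
have frobD (x y : K) : (x + y) ^+ p = x ^+ p + y ^+ p.
  by rewrite -!(pFrobenius_autE pK) rmorphD.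
have frobB (x y : K) : (x - y) ^+ p = x ^+ p - y ^+ p.
  by rewrite -!(pFrobenius_autE pK) rmorphB.
have critb : (crit K).[a ^+ p] = 0.
  rewrite -[RHS](pFrobenius_aut0 pK) -crita !critE pFrobenius_autE !frobD !exprMn.
  rewrite -[2%:R ^+ p](pFrobenius_autE pK) pFrobenius_aut_nat expr1n; ring.
(* [F(a) = 0] becomes the equation of the fibre through [a] and [a ^+ p]. *)
have ap : a = a ^+ p.
  apply: crit_fiber => //.
  have := congr1 (fun x => (a ^+ 2 + a + 1) * (a - 1) * x) Fa0.
  rewrite mulr0.
  have -> : (a ^+ 2 + a + 1) * (a - 1)
      * ((a ^+ 2 + a + 1) ^+ p * (a - 1) ^+ p.-1
         - ((a ^+ 2 + a + 1) * (a - 1)) ^+ p.-1 - (a ^+ 2 + a + 1) ^+ p + 1)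
    = (a ^+ 2 + a) * ((a ^+ 2 + a + 1) ^+ p * (a - 1) ^+ p)
      - (a ^+ 2 + a + 1) * (a - 1) * ((a ^+ 2 + a + 1) ^+ p - 1).
    rewrite exprMn !expp; ring.
  rewrite frobB !frobD !expr1n (exprAC a 2 p) => E.
  apply: subr0_eq; rewrite -E; ring.
have a_neq0 : a != 0.
  apply/eqP => a0; move/eqP: crita; rewrite critE a0 !expr0n /= !mulr0 !add0r.
  by rewrite oner_eq0.
have ap1 : a ^+ p.-1 = 1 by apply: (mulfI a_neq0); rewrite -expp -ap mulr1.
have aP : root (map_poly intr (\prod_(d <- S_seq p 3) 'Phi_d)) a.
  apply: root_prod_Cyclotomic => //; first exact: prime_gt1.
  by rewrite Cyclotomic3 !rmorphD rmorph1 /= map_polyXn map_polyX rootE !hornerE.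
(* The double root of [f] meets a root of the cyclotomic part. *)
have : ('X - a%:P) ^+ 3 %| map_poly intr (F_poly (p * 3)).
  by rewrite FE exprSr dvdp_mul // ?dvdp_mulr // -root_factor_theorem.
move/dvdp_deriv_XsubC_exp; rewrite deriv_F_poly_mod_p // Gauss_dvdpr.
  exact/negP/crit_separable.
rewrite coprimep_expl // coprimep_sym coprimep_XsubC rootN rootE !hornerE.
by rewrite expf_neq0 // mulf_neq0.
Qed.

(** * From positive characteristic to characteristic 0 *)

(** Since [f] is monic, its monic factors keep their degree over [K], whatever
    the characteristic of [K]. *)
Lemma separable_over_Z_lift (K : closedFieldType) (f : {poly int}) :
  f \is monic -> no_repeated_root (map_poly intr f : {poly K}) ->
  separable_over_Z f.
Proof.
move=> f_monic sepK a; apply/negP => /dvdp_XsubC_sqr_root [fa f'a].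
have intC_inj : injective (intr : int -> algC) by exact: intr_inj.
(* The minimal polynomial of [a], with its integer coefficients. *)
have [m [m_monic ma m_min]] : exists m : {poly int}, [/\ m \is monic,
    root (map_poly intr m : {poly algC}) a & forall q : {poly int},
    root (map_poly intr q : {poly algC}) a -> q != 0 -> (size m <= size q)%N].
  have : a \in Aint.
    apply: (root_monic_Aint fa); first by rewrite monic_map.
    by apply/polyOverP => i; rewrite coef_map /= intr_int.
  rewrite unfold_in => /floorpP [m Dm]; exists m.
  have {}Dm : minCpoly a = map_poly intr m := Dm.
  have m_monic : (map_poly intr m : {poly algC}) \is monic.
    by rewrite -Dm minCpoly_monic.
  split.
  - move: m_monic; rewrite !monicE lead_coef_map_inj //.
    by move/eqP/(intC_inj _ 1) => ->.
  - by rewrite -Dm root_minCpoly.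
  - move=> q qa q_neq0; rewrite -(size_map_inj_poly intC_inj) // -Dm.
    rewrite -[leqRHS](size_map_inj_poly intC_inj) //.
    rewrite -(map_poly_rmorph_intr (ratr : {rmorphism rat -> algC})).
    rewrite size_map_poly.
    have [r [-> _] dv] := minCpolyP a; rewrite size_map_poly dvdp_leq //.
      by rewrite map_poly_eq0_id0 // intr_eq0 lead_coef_eq0.
    by rewrite -dv map_poly_rmorph_intr.
have m_dvd q : root (map_poly intr q : {poly algC}) a -> exists k, q = k * m.
  move=> qa; exists (Pdiv.Ring.rdivp q m).
  have Dq := Pdiv.RingMonic.rdivp_eq m_monic q.
  rewrite {1}Dq; have [->|r_neq0] := eqVneq (Pdiv.Ring.rmodp q m) 0.
    by rewrite addr0.
  have := m_min (Pdiv.Ring.rmodp q m); rewrite r_neq0 leqNgt.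
  rewrite Pdiv.Ring.ltn_rmodp monic_neq0 // => /(_ _ isT) absurd.
  suff /absurd : root (map_poly intr (Pdiv.Ring.rmodp q m) : {poly algC}) a by [].
  move: qa; rewrite {1}Dq !rootE rmorphD rmorphM hornerD hornerM.
  by rewrite (rootP ma) mulr0 add0r.
have m_gt1 : (1 < size m)%N.
  rewrite -(size_map_inj_poly intC_inj) //; apply: root_size_gt1 ma.
  by rewrite monic_neq0 // monic_map.
have [k Df] := m_dvd f fa.
have m'_neq0 : m^`() != 0.
  apply: contraTneq m_gt1 => m'0; rewrite -leqNgt.
  have /eqP := congr1 (fun q : {poly int} => q`_(size m).-2) m'0.
  rewrite coef_deriv coef0.
  case E : (size m) => [|[|n]] //=.
  rewrite mulrn_eq0 /= -[n.+1]/(n.+2.-1) -E -lead_coefE lead_coef_eq0.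
  by rewrite (negbTE (monic_neq0 m_monic)).
(* [f'(a) = m'(a) k(a)], and [m'(a)] is nonzero by minimality of [m]. *)
have ka : root (map_poly intr k : {poly algC}) a.
  move: f'a; rewrite deriv_map Df derivM rmorphD !rmorphM /= !rootE hornerD !hornerM.
  rewrite (rootP ma) mulr0 add0r mulf_eq0 => /orP [] // m'a.
  have := m_min _ m'a m'_neq0; rewrite leqNgt lt_size_deriv //.
  by rewrite monic_neq0.
have [l Dk] := m_dvd k ka.
have [b mb] : exists b : K, root (map_poly intr m) b.
  apply/closed_rootP; rewrite size_map_poly_id0.
    by case: (size m) m_gt1 => [|[]].
  by rewrite (monicP m_monic) rmorph1 oner_eq0.
have /negP [] := sepK b.
rewrite Df Dk -mulrA -expr2 rmorphM rmorphXn /= dvdp_mull // dvdp_exp2r //.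
by rewrite -root_factor_theorem.
Qed.

(** * The trace polynomial *)

(** The substitution [g(X + 1/X)], in the field of fractions of [R[X]]. *)
Definition laurent_comp (R : idomainType) (g : {poly R}) : {fraction {poly R}} :=
  (map_poly (@tofrac {poly R} \o polyC) g).[tofrac 'X + (tofrac 'X)^-1].

Lemma tofracX_neq0 (R : idomainType) : tofrac ('X : {poly R}) != 0.
Proof. by rewrite tofrac_eq0 polyX_eq0. Qed.

Lemma tofracX_mul_laurentX (R : idomainType) :
  tofrac 'X * (tofrac 'X + (tofrac 'X)^-1)
  = tofrac ('X^2 + 1) :> {fraction {poly R}}.
Proof.
by rewrite mulrDr divff ?tofracX_neq0 // tofracD tofrac1 tofracM.
Qed.

Lemma laurent_compMD (R : idomainType) (g : {poly R}) (c : R) :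
  laurent_comp (g * 'X + c%:P)
  = laurent_comp g * (tofrac 'X + (tofrac 'X)^-1) + tofrac c%:P.
Proof.
by rewrite /laurent_comp rmorphD rmorphM /= map_polyX map_polyC !hornerE.
Qed.

(** A power of [X] clears the denominators of [g(X + 1/X)], compatibly with a
    change of coefficients [phi]; this is how an identity over the integers is
    carried over to the algebraic numbers. *)
Lemma laurent_comp_clear (R S : idomainType) (phi : {rmorphism R -> S})
    (g : {poly R}) :
  exists n : nat, exists h : {poly R},
    tofrac 'X ^+ n * laurent_comp g = tofrac h /\
    tofrac 'X ^+ n * laurent_comp (map_poly phi g) = tofrac (map_poly phi h).
Proof.
elim/poly_ind: g => [|g c [n [h [hR hS]]]].
  by exists 0%N, 0; rewrite /laurent_comp !rmorph0 !horner0 !mulr0.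
have step (T : idomainType) (q k : {poly T}) (d : T) :
    tofrac 'X ^+ n * laurent_comp q = tofrac k ->
    tofrac 'X ^+ n.+1 * laurent_comp (q * 'X + d%:P)
      = tofrac (k * ('X^2 + 1) + d%:P * 'X^(n.+1)).
  move=> qk; rewrite laurent_compMD tofracD !(tofracM, tofracXn) -qk.
  by rewrite -tofracX_mul_laurentX exprS; ring.
exists n.+1, (h * ('X^2 + 1) + c%:P * 'X^(n.+1)); split; first exact: step.
have -> : map_poly phi (g * 'X + c%:P) = map_poly phi g * 'X + (phi c)%:P.
  by rewrite rmorphD rmorphM /= map_polyX map_polyC.
rewrite (step _ _ _ _ hS); congr tofrac.
rewrite rmorphD (rmorphM _ h) (rmorphM _ c%:P) rmorphD rmorph1 /=.
by rewrite !map_polyXn map_polyC.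
Qed.

Lemma trace_poly_separable (f g : {poly int}) :
  is_trace_poly f g -> separable_over_Z f -> separable_over_Z g.
Proof.
rewrite /is_trace_poly; set m := _./2 => fg sepf y; apply/negP => /dvdpP [k Dg].
have [x /andP [x_neq0 xy]] : exists x : algC, (x != 0) && (x ^+ 2 + 1 == y * x).
  have /closed_rootP [x] : size ('X^2 - y%:P * 'X + 1 : {poly algC}) != 1%N.
    rewrite -addrA size_polyDl size_polyXn // (leq_ltn_trans (size_polyD _ _)) //.
    rewrite gtn_max size_poly1 size_polyN andbT.
    by rewrite mul_polyC (leq_ltn_trans (size_scale_leq _ _)) // size_polyX.
  rewrite rootE !hornerE => /eqP xE; exists x; apply/andP; split.
    apply/eqP => x0; move/eqP: xE; rewrite x0 expr0n /= !mulr0 subrr add0r.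
    by rewrite oner_eq0.
  by rewrite -subr_eq0 -xE; apply/eqP; ring.
have [n [h [hZ hC]]] := laurent_comp_clear (intr : {rmorphism int -> algC}) g.
have [n' [h' [hk _]]] :=
  laurent_comp_clear (idfun : {rmorphism algC -> algC}) k.
have gw : laurent_comp g = (tofrac 'X) ^- m * tofrac f.
  rewrite -fg /laurent_comp; congr (_.[_]); apply: eq_map_poly => c /=.
  by rewrite -[c in LHS]intz -!(rmorph_int (@tofrac {poly int} \o polyC)).
have fh : f * 'X^n = h * 'X^m.
  apply/eqP; rewrite -tofrac_eq !tofracM !tofracXn -hZ gw; apply/eqP.
  rewrite -[RHS]mulrA (mulrAC _^-1) mulVf ?expf_neq0 ?tofracX_neq0 //.
  by rewrite mul1r mulrC.
(* [g = k (X - y)^2], and [X (X + 1/X - y) = X^2 + 1 - y X]. *)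
have hh' : map_poly intr h * 'X^(n'.+2)
    = h' * ('X^2 + 1 - y%:P * 'X) ^+ 2 * 'X^n :> {poly algC}.
  apply/eqP; rewrite -tofrac_eq tofracM tofracXn -hC (tofracM _ 'X^n) (tofracM h').
  rewrite !tofracXn tofracB -hk (exprS _ n'.+1) (exprS _ n').
  rewrite tofracM -tofracX_mul_laurentX Dg /laurent_comp rmorphM rmorphXn rmorphB /=.
  rewrite map_polyX map_polyC !hornerE /=; apply/eqP; ring.
have fC : map_poly intr f * 'X^(n + n'.+2)
    = h' * ('X^2 + 1 - y%:P * 'X) ^+ 2 * 'X^(n + m) :> {poly algC}.
  have /(congr1 (map_poly (intr : int -> algC))) := fh.
  rewrite !rmorphM /= !map_polyXn => fhC.
  by rewrite exprD mulrA fhC mulrAC hh' exprD mulrA.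
have := sepf x; apply/negP; rewrite negbK.
have cop : coprimep (('X - x%:P) ^+ 2) 'X^(n + n'.+2).
  rewrite coprimep_expl // coprimep_expr // coprimep_sym coprimep_XsubC.
  by rewrite rootX.
rewrite -(Gauss_dvdpl _ cop) fC dvdp_mulr // dvdp_mull // dvdp_exp2r //.
by rewrite -root_factor_theorem rootE !hornerE (eqP xy) subrr.
Qed.

End Separability.

Theorem corollary4p7 (p : nat) (p_prime : prime p) (p_gt3 : 3 < p)
    (f : {poly int}) (fE : is_f_poly p 3 f) :
  separable_over_Fp p f /\
  separable_over_Z f /\
  (forall g : {poly int}, is_trace_poly f g -> separable_over_Z g).
Proof.
have sepFp : separable_over_Fp p f.
  move=> K iota _; rewrite map_poly_rmorph_intr.
  apply: (f_poly_mod_p_no_repeated_root _ p_gt3 fE).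
  by apply: (GRing.rmorph_pchar iota); apply: pchar_Fp.
have sepZ : separable_over_Z f.
  have [K [iota iotaP]] := countable_algebraic_closure 'F_p.
  apply: (separable_over_Z_lift (K := K)).
    apply: f_poly_monic fE; rewrite (leq_trans (prime_gt1 p_prime)) //.
    by rewrite leq_pmulr.
  by have := sepFp K iota iotaP; rewrite map_poly_rmorph_intr.
by split=> //; split=> // g /trace_poly_separable; apply.
Qed.
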